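(* For every based simplicial set $K$, $K\otimes Com$ is a cofibrant right $Com$-module.
   Context: $Sp$ is the category of symmetric spectra (Hovey–Shipley–Smith), with smash product $\wedge$ and unit the sphere spectrum $\mathbb S$, tensored over based simplicial sets via $K\wedge X$. It carries a model structure for stable homotopy theory (that of Hovey–Shipley–Smith, in the version used by Kuhn–Pereira, Algebr. Geom. Topol. 17 (2017)), compatible with $\wedge$ and with the tensoring over based simplicial sets, and in which $\mathbb S$ is cofibrant. $\mathrm{Sym}(Sp)$ is the category of symmetric sequences $M=\{M(n)\}_{n\ge0}$, with $M(n)$ a spectrum with $\Sigma_n$-action; a map in $\mathrm{Sym}(Sp)$ is a weak equivalence or cofibration if it is one levelwise (on underlying spectra). Set $(M\otimes N)(n)=\bigvee_{l+m=n}\Sigma_{n+}\wedge_{\Sigma_l\times\Sigma_m}(M(l)\wedge N(m))$ and $(M\circ N)(n)=\bigvee_{r\ge 0}M(r)\wedge_{\Sigma_r}N^{\otimes r}(n)$; operads are monoids for $\circ$. $Com=( *,\mathbb S,\mathbb S,\dots)$ is the reduced commutative operad, with identity structure maps. Right $Com$-modules $M$ are required to satisfy $M(0)=*$; equivalently they are functors $\mathrm{Epi}^{op}\to Sp$, where $\mathrm{Epi}$ has objects $\mathbf n=\{1,\dots,n\}$, $n\ge1$, and morphisms the surjections. The category of right $Com$-modules has the model structure in which a map is a weak equivalence or fibration if it is one in $\mathrm{Sym}(Sp)$, and generating cofibrations are of the form $M\circ Com\to N\circ Com$ with $M\to N$ a cofibration in $\mathrm{Sym}(Sp)$. For a based simplicial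 set $K$, the right $Com$-module $K\otimes Com$ is defined by $(K\otimes Com)(n)=K^{\wedge n}\wedge\mathbb S$ for $n\ge1$, $(K\otimes Com)(0)=*$, where a surjection $\phi:\mathbf r\to\mathbf n$ acts through the diagonal $\Delta_\phi:K^{\wedge n}\to K^{\wedge r}$, $x_1\wedge\dots\wedge x_n\mapsto x_{\phi(1)}\wedge\dots\wedge x_{\phi(r)}$. *)

(* Defs.v *)
From Stdlib Require Import Relation_Operators.
From mathcomp Require Import all_boot all_fingroup.
From mathcomp Require Import boolp.

Set Implicit Arguments.
Unset Strict Implicit.
Unset Printing Implicit Defensive.

Record category := Category {
  obj :> Type;
  hom : obj -> obj -> Type;
  idm : forall x, hom x x;
  comp : forall x y z, hom y z -> hom x y -> hom x z;
  comp1m : forall x y (f : hom x y), comp (idm y) f = f;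
  compm1 : forall x y (f : hom x y), comp f (idm x) = f;
  compA : forall x y z t (f : hom z t) (g : hom y z) (h : hom x y),
    comp f (comp g h) = comp (comp f g) h
}.
Arguments idm {c} x.
Arguments comp {c x y z}.

Definition morph_class (C : category) := forall x y : C, hom x y -> Prop.

Section CategoryNotions.
Variable C : category.

Definition is_initial (x : C) : Prop :=
  forall y : C, exists f : hom x y, forall g : hom x y, g = f.

Definition lifts (a b x y : C) (f : hom a b) (g : hom x y) : Prop :=
  forall (u : hom a x) (v : hom b y), comp g u = comp v f ->
  exists h : hom b x, comp h f = u /\ comp g h = v.

Definition is_retract (a b x y : C) (f : hom a b) (g : hom x y) : Prop :=
  exists (i : hom a x) (r : hom x a) (j : hom b y) (q : hom y b),
    [/\ comp r i = idm a, comp q j = idm b,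
        comp g i = comp j f & comp f r = comp q g].

Definition is_pushout (a b c p : C) (u : hom a b) (v : hom a c)
    (i : hom b p) (j : hom c p) : Prop :=
  comp i u = comp j v /\
  forall (d : C) (i' : hom b d) (j' : hom c d), comp i' u = comp j' v ->
  exists h : hom p d, [/\ comp h i = i', comp h j = j' &
    forall h' : hom p d, comp h' i = i' -> comp h' j = j' -> h' = h].

(* For a commutative square [v' u = u' v]: the map from any pushout of [u] and
   [v] to [d] lies in the class [P]. *)
Definition corner_map_in (P : morph_class C) (a b c d : C)
    (u : hom a b) (v : hom a c) (v' : hom b d) (u' : hom c d) : Prop :=
  forall (p : C) (i : hom b p) (j : hom c p) (h : hom p d),
  is_pushout u v i j -> comp h i = v' -> comp h j = u' -> P p d h.

Record model_structure := ModelStructure {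
  weq : morph_class C;
  cof : morph_class C;
  fib : morph_class C;
  weq_comp : forall x y z (f : hom x y) (g : hom y z),
    weq f -> weq g -> weq (comp g f);
  weq_cancel_l : forall x y z (f : hom x y) (g : hom y z),
    weq g -> weq (comp g f) -> weq f;
  weq_cancel_r : forall x y z (f : hom x y) (g : hom y z),
    weq f -> weq (comp g f) -> weq g;
  weq_retract : forall a b x y (f : hom a b) (g : hom x y),
    is_retract f g -> weq g -> weq f;
  cof_retract : forall a b x y (f : hom a b) (g : hom x y),
    is_retract f g -> cof g -> cof f;
  fib_retract : forall a b x y (f : hom a b) (g : hom x y),
    is_retract f g -> fib g -> fib f;
  cof_acyclic_fib_lifts : forall a b x y (f : hom a b) (g : hom x y),
    cof f -> fib g -> weq g -> lifts f g;
  acyclic_cof_fib_lifts : forall a b x y (f : hom a b) (g : hom x y),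
    cof f -> weq f -> fib g -> lifts f g;
  cof_acyclic_fib_factor : forall x y (f : hom x y),
    exists (z : C) (i : hom x z) (p : hom z y),
      [/\ f = comp p i, cof i, fib p & weq p];
  acyclic_cof_fib_factor : forall x y (f : hom x y),
    exists (z : C) (i : hom x z) (p : hom z y),
      [/\ f = comp p i, cof i, weq i & fib p]
}.

Definition cofibrant (M : model_structure) (x : C) : Prop :=
  exists (e : C) (f : hom e x), is_initial e /\ cof M f.

End CategoryNotions.

Record simplex_map (m n : nat) := SimplexMap {
  sm_fun :> 'I_m.+1 -> 'I_n.+1;
  sm_mono : forall i j : 'I_m.+1, i <= j -> sm_fun i <= sm_fun j
}.

Lemma simplex_map_eq m n (f g : simplex_map m n) : f =1 g -> f = g.
Proof.
case: f g => [f hf] [g hg] /= /funext efg; case: _ / efg hg => hg.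
by congr SimplexMap; apply: Prop_irrelevance.
Qed.

Definition simplex_id n : simplex_map n n :=
  @SimplexMap n n id (fun i j h => h).

Definition simplex_comp m n p (f : simplex_map n p) (g : simplex_map m n) :
  simplex_map m p :=
  @SimplexMap m p (fun i => f (g i)) (fun i j h => sm_mono f (sm_mono g h)).

Definition simplex_const m n (i : 'I_n.+1) : simplex_map m n :=
  @SimplexMap m n (fun=> i) (fun _ _ _ => leqnn i).

Record sset := SSet {
  simp :> nat -> Type;
  sact : forall m n, simplex_map m n -> simp n -> simp m;
  sact1 : forall n (x : simp n), sact (simplex_id n) x = x;
  sactM : forall m n p (f : simplex_map n p) (g : simplex_map m n) (x : simp p),
    sact (simplex_comp f g) x = sact g (sact f x)
}.
Arguments sact {s m n}.

Record ssmap (X Y : sset) := SSMap {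
  ss_fun :> forall k, X k -> Y k;
  ss_nat : forall m n (f : simplex_map m n) (x : X n),
    ss_fun (sact f x) = sact f (ss_fun x)
}.
Arguments ss_fun {X Y} s {k}.

Definition Delta (n : nat) : sset.
Proof.
refine (@SSet (fun k => simplex_map k n) (fun m k f x => simplex_comp x f) _ _).
- by move=> k x; apply: simplex_map_eq.
- by move=> m k p f g x; apply: simplex_map_eq.
Defined.

Definition prod_sset (X Y : sset) : sset.
Proof.
refine (@SSet (fun k => X k * Y k)%type
  (fun m n f xy => (sact f xy.1, sact f xy.2)) _ _).
- by move=> n [x y]; rewrite /= !sact1.
- by move=> m n p f g [x y]; rewrite /= !sactM.
Defined.

Definition pow_sset (X : sset) (n : nat) : sset.
Proof.
refine (@SSet (fun k => 'I_n -> X k) (fun m k f x i => sact f (x i)) _ _).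
- by move=> k x; apply: funext => i; rewrite sact1.
- by move=> m k p f g x; apply: funext => i; rewrite sactM.
Defined.

Definition subcomplex (X : sset) (L : forall k, X k -> Prop) : Prop :=
  forall m n (f : simplex_map m n) (x : X n), L n x -> L m (sact f x).

Definition sub_sset (X : sset) (L : forall k, X k -> Prop)
  (hL : subcomplex L) : sset.
Proof.
refine (@SSet (fun k => {x : X k | L k x})
  (fun m n f x => exist (L m) (sact f (sval x)) (hL m n f _ (svalP x))) _ _).
- by move=> n [x hx]; apply: eq_exist; rewrite /= sact1.
- by move=> m n p f g [x hx]; apply: eq_exist; rewrite /= sactM.
Defined.

Lemma horn_subcomplex n (i : 'I_n.+1) :
  @subcomplex (Delta n) (fun k (x : simplex_map k n) =>
    exists l : 'I_n.+1, l != i /\ forall a, x a != l).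
Proof. by move=> m k f x [l [li hl]]; exists l; split=> // a; apply: hl. Qed.

Definition horn n (i : 'I_n.+1) : sset := sub_sset (@horn_subcomplex n i).

Definition kan (Z : sset) : Prop :=
  forall (n : nat) (i : 'I_n.+2) (h : ssmap (horn i) Z),
  exists z : Z n.+1, forall k (x : horn i k), h k x = sact (sval x) z.

Definition ss_homotopy (X Y : sset) (f g : ssmap X Y) : Prop :=
  exists H : ssmap (prod_sset X (Delta 1)) Y,
    forall k (x : X k), H k (x, simplex_const k ord0) = f k x
                     /\ H k (x, simplex_const k ord_max) = g k x.

Definition ss_homotopic (X Y : sset) (f g : ssmap X Y) : Prop :=
  clos_refl_sym_trans (ssmap X Y) (@ss_homotopy X Y) f g.

Definition ss_comp (X Y Z : sset) (g : ssmap Y Z) (f : ssmap X Y) : ssmap X Z.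
Proof.
by refine (@SSMap X Z (fun k x => g k (f k x)) _) => m n h x; rewrite !ss_nat.
Defined.

(* [f] induces a bijection [Y, Z] -> [X, Z] for every Kan complex [Z]; this is
   equivalent to the realization of [f] being a weak homotopy equivalence. *)
Definition ss_weq (X Y : sset) (f : ssmap X Y) : Prop :=
  forall Z : sset, kan Z ->
    (forall h : ssmap X Z, exists g : ssmap Y Z, ss_homotopic (ss_comp g f) h)
 /\ (forall g g' : ssmap Y Z,
       ss_homotopic (ss_comp g f) (ss_comp g' f) -> ss_homotopic g g').

Record psset := PSSet {
  ps_sset :> sset;
  bpt : forall k, ps_sset k;
  bpt_act : forall m n (f : simplex_map m n), sact f (bpt n) = bpt m
}.
Arguments bpt {p k}.

Record psmap (K L : psset) := PSMap {
  ps_map :> ssmap K L;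
  ps_bpt : forall k, ps_map k bpt = bpt
}.

Lemma ssmap_eq (X Y : sset) (f g : ssmap X Y) :
  (forall k x, f k x = g k x) -> f = g.
Proof.
case: f g => [f hf] [g hg] /= efg.
have e : f = g.
  by apply: functional_extensionality_dep => k; apply: funext => x.
by case: _ / e hg {efg} => hg; congr SSMap; apply: Prop_irrelevance.
Qed.

Lemma psmap_eq (K L : psset) (f g : psmap K L) :
  (forall k x, f k x = g k x) -> f = g.
Proof.
case: f g => [f hf] [g hg] /= /ssmap_eq e.
by case: _ / e hg => hg; congr PSMap; apply: Prop_irrelevance.
Qed.

Definition ps_id (K : psset) : psmap K K :=
  @PSMap K K (@SSMap K K (fun k x => x) (fun m n f x => erefl)) (fun k => erefl).

Definition ps_comp (K L M : psset) (g : psmap L M) (f : psmap K L) : psmap K M.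
Proof.
by refine (@PSMap K M (ss_comp g f) _) => k /=; rewrite !ps_bpt.
Defined.

(* [T / L] as a based set with basepoint [None]; for empty [L] this adds a
   disjoint basepoint. *)
Definition collapse (T : Type) (L : T -> Prop) : Type := option {x : T | ~ L x}.

Definition cls (T : Type) (L : T -> Prop) (x : T) : collapse L :=
  match pselect (L x) with
  | left _ => None
  | right h => Some (exist (fun x => ~ L x) x h)
  end.

Definition collapse_rec (T U : Type) (L : T -> Prop) (f : T -> U) (u : U)
  (o : collapse L) : U := if o is Some x then f (sval x) else u.

Lemma cls_None (T : Type) (L : T -> Prop) (x : T) : L x -> cls L x = None.
Proof. by rewrite /cls; case: pselect. Qed.

Lemma collapse_recE (T U : Type) (L : T -> Prop) (f : T -> U) (u : U) (x : T) :
  (L x -> f x = u) -> collapse_rec f u (cls L x) = f x.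
Proof. by rewrite /cls; case: pselect => //= hx ->. Qed.

Lemma collapse_case (T : Type) (L : T -> Prop) (P : collapse L -> Prop) :
  P None -> (forall x, ~ L x -> P (cls L x)) -> forall o, P o.
Proof.
move=> P0 P1 [[x hx]|] //; have := P1 x hx; rewrite /cls.
by case: pselect => // h; rewrite (Prop_irrelevance h hx).
Qed.

Definition quot_sset (X : sset) (L : forall k, X k -> Prop)
  (hL : subcomplex L) : psset.
Proof.
unshelve refine (@PSSet (@SSet (fun k => collapse (L k))
  (fun m n f => collapse_rec (fun x => cls (L m) (sact f x)) None) _ _)
  (fun=> None) _).
- move=> n; apply: collapse_case => //= x hx.
  by rewrite collapse_recE ?sact1 // => /cls_None.
- move=> m n p f g; apply: collapse_case => //= x hx.
  rewrite collapse_recE => [|h]; last by apply: cls_None; exact: hL.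
  rewrite collapse_recE => [|h]; last by apply: cls_None; exact: hL.
  rewrite collapse_recE => [|h]; last by apply: cls_None; exact: hL.
  by rewrite sactM.
- by [].
Defined.

Definition quot_map (X Y : sset) (L : forall k, X k -> Prop)
  (M : forall k, Y k -> Prop) (hL : subcomplex L) (hM : subcomplex M)
  (f : ssmap X Y) (hf : forall k x, L k x -> M k (f k x)) :
  psmap (quot_sset hL) (quot_sset hM).
Proof.
unshelve refine (@PSMap (quot_sset hL) (quot_sset hM)
  (@SSMap (quot_sset hL) (quot_sset hM)
    (fun k => collapse_rec (fun x => cls (M k) (f k x)) None) _) _).
- move=> m n g; apply: collapse_case => //= x hx.
  rewrite collapse_recE => [|h]; last by apply: cls_None; exact: hL.
  rewrite collapse_recE => [|h]; last by apply: cls_None; exact: hf.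
  rewrite collapse_recE => [|h]; last by apply: cls_None; exact: hf.
  rewrite collapse_recE => [|h]; last by apply: cls_None; exact: hM.
  by rewrite ss_nat.
- by [].
Defined.

Lemma wedge_subcomplex (K L : psset) :
  @subcomplex (prod_sset K L) (fun k xy => xy.1 = bpt \/ xy.2 = bpt).
Proof.
by move=> m n f [x y] /= [] ->; rewrite bpt_act; [left|right].
Qed.

Definition smash (K L : psset) : psset := quot_sset (@wedge_subcomplex K L).

Definition smash_map (K K' L L' : psset) (f : psmap K K') (g : psmap L L') :
  psmap (smash K L) (smash K' L').
Proof.
unshelve refine (@quot_map (prod_sset K L) (prod_sset K' L') _ _ _ _
  (@SSMap (prod_sset K L) (prod_sset K' L')
     (fun k xy => (f k xy.1, g k xy.2)) _) _).
- by move=> m n h [x y]; rewrite /= !ss_nat.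
- by move=> k [x y] /= [] ->; rewrite ps_bpt; [left|right].
Defined.

Lemma fat_wedge_subcomplex (K : psset) (n : nat) :
  @subcomplex (pow_sset K n) (fun k x => exists i, x i = bpt).
Proof. by move=> m p f x [i xi]; exists i; rewrite /= xi bpt_act. Qed.

(* [smash_pow K 0] is [S^0]. *)
Definition smash_pow (K : psset) (n : nat) : psset :=
  quot_sset (@fat_wedge_subcomplex K n).

Lemma empty_subcomplex (X : sset) : @subcomplex X (fun _ _ => False).
Proof. by []. Qed.

Definition plus (X : sset) : psset := quot_sset (@empty_subcomplex X).

Lemma boundary_subcomplex n :
  @subcomplex (Delta n) (fun k (x : simplex_map k n) =>
    exists l : 'I_n.+1, forall a, x a != l).
Proof. by move=> m k f x [l hl]; exists l => a; apply: hl. Qed.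

(* [Delta[1]] modulo its boundary. *)
Definition S1 : psset := quot_sset (@boundary_subcomplex 1).

(* A based map [K /\ L -> Z] out of a smash product, written in two variables. *)
Record bimap (K L Z : psset) := BiMap {
  bi_fun :> forall k, K k -> L k -> Z k;
  bi_nat : forall m n (f : simplex_map m n) (x : K n) (y : L n),
    bi_fun (sact f x) (sact f y) = sact f (bi_fun x y);
  bi_ptl : forall k (y : L k), bi_fun bpt y = bpt;
  bi_ptr : forall k (x : K k), bi_fun x bpt = bpt
}.
Arguments bi_fun {K L Z} b {k}.

Lemma bimap_eq (K L Z : psset) (f g : bimap K L Z) :
  (forall k x y, f k x y = g k x y) -> f = g.
Proof.
case: f g => [f f1 f2 f3] [g g1 g2 g3] /= efg.
have e : f = g.
  apply: functional_extensionality_dep => k.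
  by apply: funext => x; apply: funext => y.
case: _ / e g1 g2 g3 {efg} => g1 g2 g3.
by congr BiMap; apply: Prop_irrelevance.
Qed.

Definition bi_precomp (K K' L Z : psset) (h : bimap K L Z) (f : psmap K' K) :
  bimap K' L Z.
Proof.
refine (@BiMap K' L Z (fun k x y => h k (f k x) y) _ _ _).
- by move=> m n g x y; rewrite ss_nat bi_nat.
- by move=> k y; rewrite ps_bpt bi_ptl.
- by move=> k x; rewrite bi_ptr.
Defined.

Definition Delta_map m n (f : simplex_map m n) : ssmap (Delta m) (Delta n).
Proof.
refine (@SSMap (Delta m) (Delta n) (fun k x => simplex_comp f x) _).
by move=> p q g x; apply: simplex_map_eq.
Defined.

Definition plus_map (X Y : sset) (f : ssmap X Y) : psmap (plus X) (plus Y) :=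
  @quot_map X Y _ _ (@empty_subcomplex X) (@empty_subcomplex Y) f
    (fun _ _ h => h).

(* The based function complex: an n-simplex is a based map
   [Delta[n]_+ /\ K -> Z]. *)
Definition map_cpx (K Z : psset) : sset.
Proof.
refine (@SSet (fun n => bimap (plus (Delta n)) K Z)
  (fun m n f h => bi_precomp h (plus_map (Delta_map f))) _ _).
- move=> n h; apply: bimap_eq => k x y /=; congr (h k _ y).
  elim/collapse_case: x => //= x hx; rewrite collapse_recE //.
  by congr cls; apply: simplex_map_eq.
- move=> m n p f g h; apply: bimap_eq => k x y /=; congr (h k _ y).
  by elim/collapse_case: x => //= x hx; rewrite !collapse_recE.
Defined.

(* The adjoint [L -> Map_*(K, Z)] of a based map [K /\ L -> Z]; on a simplex
   [x : L n] it is [(t, s) |-> h s (x t)]. *)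
Definition adjoint_map (K L Z : psset) (h : bimap K L Z) :
  ssmap L (map_cpx K Z).
Proof.
unshelve refine (@SSMap L (map_cpx K Z) (fun n x =>
  @BiMap (plus (Delta n)) K Z (fun k t s =>
    h k s (collapse_rec (fun f : Delta n k => sact f x) bpt t)) _ _ _) _).
- move=> p q g t s; rewrite -bi_nat; congr (h p _ _).
  elim/collapse_case: t => [|t ht] /=; first by rewrite bpt_act.
  by rewrite !collapse_recE //= sactM.
- by move=> k s; rewrite /= bi_ptr.
- by move=> k t; rewrite bi_ptl.
- move=> m n f x; apply: bimap_eq => k t s /=; congr (h k s _).
  elim/collapse_case: t => //= t ht.
  by rewrite !collapse_recE //= sactM.
Defined.

(* The iterated structure map [S^p /\ X_n -> X_(p+n)]; the first circle
   coordinate is applied last. *)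
Fixpoint iter_sigma (X : nat -> psset)
  (sigma : forall n, bimap S1 (X n) (X n.+1)) (p n k : nat) :
  ('I_p -> S1 k) -> X n k -> X (p + n) k :=
  match p with
  | 0 => fun _ x => x
  | q.+1 => fun s x =>
      sigma (q + n) k (s ord0) (iter_sigma sigma (fun i => s (lift ord0 i)) x)
  end.

Section PermSum.
Variables (p n : nat) (g : 'S_p) (h : 'S_n).

Definition perm_sum_fun (i : 'I_(p + n)) : 'I_(p + n) :=
  match split i with
  | inl a => lshift n (g a)
  | inr b => rshift p (h b)
  end.

Lemma perm_sum_inj : injective perm_sum_fun.
Proof.
move=> i j; rewrite /perm_sum_fun.
case: (split_ordP i) => a ->; case: (split_ordP j) => b -> /eqP.
- by rewrite eq_lshift => /eqP /perm_inj ->.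
- by rewrite eq_lrshift.
- by rewrite eq_rlshift.
- by rewrite eq_rshift => /eqP /perm_inj ->.
Qed.

Definition perm_sum : 'S_(p + n) := perm perm_sum_inj.
End PermSum.

(* Product in ['S_n] is composition in diagrammatic order, so [pactM] says that
   [pact] is a left action of the permutations under composition. *)
Record spectrum := Spectrum {
  lev :> nat -> psset;
  pact : forall n, 'S_n -> psmap (lev n) (lev n);
  sigma : forall n, bimap S1 (lev n) (lev n.+1);
  pact1 : forall n k (x : lev n k), pact 1%g k x = x;
  pactM : forall n (g h : 'S_n) k (x : lev n k),
    pact (g * h)%g k x = pact h k (pact g k x);
  sigma_equiv : forall p n (g : 'S_p) (h : 'S_n) k
      (s : 'I_p -> S1 k) (x : lev n k),
    iter_sigma sigma (fun i => s ((g^-1)%g i)) (pact h k x) =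
    pact (perm_sum g h) k (iter_sigma sigma s x)
}.
Arguments pact X {n} : rename.
Arguments sigma X {n} : rename.

Record spmap (X Y : spectrum) := SpMap {
  sp_fun :> forall n, psmap (X n) (Y n);
  sp_pact : forall n (g : 'S_n) k (x : X n k),
    sp_fun n k (pact _ g k x) = pact _ g k (sp_fun n k x);
  sp_sigma : forall n k (s : S1 k) (x : X n k),
    sp_fun n.+1 k (sigma X k s x) = sigma Y k s (sp_fun n k x)
}.

Lemma spmap_eq (X Y : spectrum) (f g : spmap X Y) :
  (forall n k x, f n k x = g n k x) -> f = g.
Proof.
case: f g => [f f1 f2] [g g1 g2] /= efg.
have e : f = g.
  apply: functional_extensionality_dep => n; exact: psmap_eq.
case: _ / e g1 g2 {efg} => g1 g2.
by congr SpMap; apply: Prop_irrelevance.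
Qed.

Definition sp_id (X : spectrum) : spmap X X :=
  @SpMap X X (fun n => ps_id (X n))
    (fun _ _ _ _ => erefl) (fun _ _ _ _ => erefl).

Definition sp_comp (X Y Z : spectrum) (g : spmap Y Z) (f : spmap X Y) :
  spmap X Z.
Proof.
refine (@SpMap X Z (fun n => ps_comp (g n) (f n)) _ _).
- by move=> n h k x /=; rewrite !sp_pact.
- by move=> n k s x /=; rewrite !sp_sigma.
Defined.

Lemma sp_compA (X Y Z T : spectrum) (f : spmap Z T) (g : spmap Y Z)
  (h : spmap X Y) : sp_comp f (sp_comp g h) = sp_comp (sp_comp f g) h.
Proof. exact: spmap_eq. Qed.

Definition Sp : category.
Proof.
refine (@Category spectrum spmap sp_id sp_comp _ _ _);
  by move=> *; apply: spmap_eq.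
Defined.

Definition zero_psset : psset.
Proof.
by unshelve refine (@PSSet (@SSet (fun=> unit) (fun _ _ _ x => x) _ _)
  (fun=> tt) _).
Defined.

Definition zero_spectrum : spectrum.
Proof.
unshelve refine (@Spectrum (fun=> zero_psset) (fun _ _ => ps_id _)
  (fun n => @BiMap S1 zero_psset zero_psset (fun _ _ _ => tt) _ _ _) _ _ _);
  try by move=> *; case: (iter_sigma _ _ _).
all: by move=> * //=; do ?case: (X in X = _); do ?case: (X in _ = X).
Defined.

Definition zero_map (X Y : spectrum) : spmap X Y.
Proof.
unshelve refine (@SpMap X Y (fun n => @PSMap (X n) (Y n)
  (@SSMap (X n) (Y n) (fun k _ => bpt) _) _) _ _).
- by move=> m p f x; rewrite bpt_act.
- by [].
- by move=> n g k x /=; rewrite ps_bpt.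
- by move=> n k s x /=; rewrite bi_ptr.
Defined.

Definition catf (T : Type) (p n : nat) (s : 'I_p -> T) (t : 'I_n -> T)
  (i : 'I_(p + n)) : T :=
  match split i with inl a => s a | inr b => t b end.

Definition consf (T : Type) (n : nat) (s : T) (t : 'I_n -> T) (i : 'I_n.+1) : T :=
  if unlift ord0 i is Some j then t j else s.

Definition perm_pow_map (K : psset) (n : nat) (g : 'S_n) :
  psmap (smash_pow K n) (smash_pow K n).
Proof.
unshelve refine (@quot_map (pow_sset K n) (pow_sset K n) _ _ _ _
  (@SSMap (pow_sset K n) (pow_sset K n) (fun k x i => x ((g^-1)%g i)) _) _).
- by [].
- by move=> k x [i xi]; exists (g i); rewrite /= permK.
Defined.

Lemma collapse_pow_mapE (K : psset) n (g : 'S_n) k (x : 'I_n -> K k) :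
  perm_pow_map K g k (cls (fun x => exists i, x i = bpt) x) =
  cls _ (fun i => x ((g^-1)%g i)).
Proof.
rewrite /= collapse_recE // => -[i xi]; apply: cls_None.
by exists (g i); rewrite /= permK.
Qed.

Definition sphere_sigma (n : nat) :
  bimap S1 (smash_pow S1 n) (smash_pow S1 n.+1).
Proof.
refine (@BiMap S1 (smash_pow S1 n) (smash_pow S1 n.+1)
  (fun k s => collapse_rec (fun t => cls _ (consf s t)) None) _ _ _).
- move=> m p f s; apply: collapse_case => //= t ht.
  have consN (q : nat) (r : S1 q) (u : 'I_n -> S1 q) :
      (exists i, u i = bpt) -> exists i, consf r u i = bpt.
    by move=> [i ui]; exists (lift ord0 i); rewrite /consf liftK.
  rewrite collapse_recE => [|[i ti]]; last first.
    by apply: cls_None; exists i; rewrite /= ti.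
  rewrite collapse_recE => [|h]; last by apply: cls_None; exact: consN.
  rewrite collapse_recE => [|h]; last by apply: cls_None; exact: consN.
  rewrite collapse_recE => [|h]; last first.
    by apply: cls_None; apply: (fat_wedge_subcomplex (K := S1)).
  by congr cls; apply: funext => i; rewrite /consf; case: unlift.
- move=> k; apply: collapse_case => //= t ht.
  rewrite collapse_recE ?cls_None // => *; exists ord0;
    by rewrite /consf unlift_none.
- by [].
Defined.

Lemma iter_sphere_sigma p n k (s : 'I_p -> S1 k) (t : 'I_n -> S1 k) :
  iter_sigma sphere_sigma s (cls (fun x => exists i, x i = bpt) t) =
  cls (fun x => exists i, x i = bpt) (catf s t).
Proof.
elim: p s => [|p IHp] s /=.
  congr cls; apply: funext => i; rewrite /catf.
  case: split_ordP => [[]//|j ->]; congr t; exact: val_inj.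
rewrite IHp /= collapse_recE.
  congr cls; apply: funext => i; rewrite /consf /catf.
  case: unliftP => [j ->|->].
    case: split_ordP => a ja; case: split_ordP => b /(congr1 val);
      rewrite /= /bump leq0n ja /= => e.
    - by congr s; apply: val_inj; rewrite /= -e.
    - by have := ltn_ord a; rewrite -ltnS -[a.+1]/(1 + a) e ltnNge leq_addr.
    - by have := ltn_ord b; rewrite -e add1n ltnS ltnNge leq_addr.
    - congr t; apply: val_inj; move/eqP: e.
      by rewrite /= add1n addSn eqSS eqn_add2l => /eqP.
  case: split_ordP => b /(congr1 val) //= e.
  by congr s; apply: val_inj.
by move=> [i hi]; apply: cls_None; exists (lift ord0 i); rewrite /consf liftK.
Qed.

Definition sphere : spectrum.
Proof.
refine (@Spectrum (smash_pow S1) (@perm_pow_map S1) sphere_sigma _ _ _).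
- move=> n k; apply: collapse_case => // x hx; rewrite collapse_pow_mapE.
  by congr cls; apply: funext => i; rewrite invg1 perm1.
- move=> n g h k; apply: collapse_case => // x hx; rewrite !collapse_pow_mapE.
  by congr cls; apply: funext => i; rewrite invMg permM.
- move=> p n g h k s; apply: collapse_case => [|x hx].
    have itN q (u : 'I_q -> S1 k) :
        iter_sigma sphere_sigma u (None : smash_pow S1 n k) = None.
      by elim: q u => //= q IHq u; rewrite IHq.
    by rewrite [X in iter_sigma _ _ X]/= !itN.
  rewrite collapse_pow_mapE !iter_sphere_sigma collapse_pow_mapE.
  congr cls; apply: funext => i; rewrite /catf.
  have -> : i = perm_sum g h ((perm_sum g h)^-1%g i) by rewrite permKV.
  move: ((perm_sum g h)^-1%g i) => j; rewrite permK permE /perm_sum_fun.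
  case: (split_ordP j) => a _.
    by rewrite -[lshift n (g a)]/(unsplit (inl (g a))) unsplitK permK.
  by rewrite -[rshift p (h a)]/(unsplit (inr (h a))) unsplitK permK.
Defined.

Section Tensor.
Variables (K : psset) (X : spectrum).

Definition tensor_sigma (n : nat) :
  bimap S1 (smash K (X n)) (smash K (X n.+1)).
Proof.
refine (@BiMap S1 (smash K (X n)) (smash K (X n.+1))
  (fun k s => collapse_rec (fun ax => cls _ (ax.1, sigma X k s ax.2)) None)
  _ _ _).
- have sN q (r : S1 q) (ax : K q * X n q) : ax.1 = bpt \/ ax.2 = bpt ->
      (ax.1, sigma X q r ax.2).1 = bpt \/ (ax.1, sigma X q r ax.2).2 = bpt.
    by case=> ->; [left|right; rewrite bi_ptr].
  move=> m p f s; apply: collapse_case => //= -[a x] hax.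
  rewrite collapse_recE => [|h]; last first.
    by apply: cls_None; exact: (@wedge_subcomplex _ _ _ _ f (a, x)).
  rewrite collapse_recE => [|h]; last by apply: cls_None; exact: sN.
  rewrite collapse_recE => [|h]; last by apply: cls_None; exact: sN.
  rewrite collapse_recE => [|h]; last first.
    apply: cls_None.
    exact: (@wedge_subcomplex K (X n.+1) _ _ f (a, sigma X p s x)).
  by rewrite /= bi_nat.
- move=> k; apply: collapse_case => //= -[a x] hax.
  by rewrite collapse_recE cls_None //=; right; rewrite bi_ptl.
- by [].
Defined.

Lemma iter_tensor_sigma p n k (s : 'I_p -> S1 k) (a : K k) (x : X n k) :
  iter_sigma tensor_sigma s (cls (fun z => z.1 = bpt \/ z.2 = bpt) (a, x)) =
  cls (fun z => z.1 = bpt \/ z.2 = bpt) (a, iter_sigma (@sigma X) s x).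
Proof.
elim: p s => // p IHp s; rewrite /= IHp /= collapse_recE //= => h.
by apply: cls_None; case: h => ->; [left|right; rewrite /= bi_ptr].
Qed.

Lemma tensor_pactE n (g : 'S_n) k (a : K k) (x : X n k) :
  smash_map (ps_id K) (pact X g) k (cls _ (a, x)) =
  cls (fun z => z.1 = bpt \/ z.2 = bpt) (a, pact X g k x).
Proof.
rewrite /= collapse_recE //= => h.
by apply: cls_None; case: h => ->; [left|right; rewrite /= ps_bpt].
Qed.

Definition tensor : spectrum.
Proof.
refine (@Spectrum (fun n => smash K (X n))
  (fun n g => smash_map (ps_id K) (pact X g)) tensor_sigma _ _ _).
- move=> n k; apply: collapse_case => // -[a x] _.
  by rewrite tensor_pactE pact1.
- move=> n g h k; apply: collapse_case => // -[a x] _.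
  by rewrite !tensor_pactE pactM.
- move=> p n g h k s; apply: collapse_case => [|[a x] _].
    have itN q (u : 'I_q -> S1 k) :
        iter_sigma tensor_sigma u (None : smash K (X n) k) = None.
      by elim: q u => //= q IHq u; rewrite IHq.
    by rewrite [X in iter_sigma _ _ X]/= !itN.
  rewrite tensor_pactE !iter_tensor_sigma tensor_pactE.
  by rewrite sigma_equiv.
Defined.
End Tensor.

Lemma smash_mapE (K K' L L' : psset) (f : psmap K K') (g : psmap L L') k
    (a : K k) (x : L k) :
  smash_map f g k (cls (fun z => z.1 = bpt \/ z.2 = bpt) (a, x)) =
  cls (fun z => z.1 = bpt \/ z.2 = bpt) (f k a, g k x).
Proof.
rewrite /= collapse_recE //= => h.
by apply: cls_None; case: h => ->; [left|right]; rewrite /= ps_bpt.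
Qed.

Definition tensor_map (K L : psset) (X Y : spectrum)
  (f : psmap K L) (g : spmap X Y) : spmap (tensor K X) (tensor L Y).
Proof.
refine (@SpMap (tensor K X) (tensor L Y) (fun n => smash_map f (g n)) _ _).
- move=> n h k; apply: collapse_case => // -[a x] _.
  by rewrite tensor_pactE !smash_mapE sp_pact.
- move=> n k s; apply: collapse_case => // -[a x] _.
  have sigmaE (M : psset) (Z : spectrum) (b : M k) (z : Z n k) :
      tensor_sigma M Z n k s (cls (fun w => w.1 = bpt \/ w.2 = bpt) (b, z)) =
      cls (fun w => w.1 = bpt \/ w.2 = bpt) (b, sigma Z k s z).
    exact: (@iter_tensor_sigma M Z 1 n k (fun=> s)).
  by rewrite sigmaE !smash_mapE sp_sigma [RHS]sigmaE.
Defined.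

Definition lev_cast (X : nat -> psset) (m n : nat) (e : m = n) (k : nat)
  (x : X m k) : X n k := eq_rect m (fun i => X i k) x n e.

(* Bilinear maps [X, Y -> Z]: families of equivariant maps
   [X_p /\ Y_q -> Z_(p+q)] compatible with the structure maps. In [bm_sigmar]
   the permutation moves the circle coordinate in position 0 past the p
   coordinates of [X_p]. *)
Record bilinear (X Y Z : spectrum) := Bilinear {
  bm_fun :> forall p q, bimap (X p) (Y q) (Z (p + q));
  bm_pact : forall p q (g : 'S_p) (h : 'S_q) k (x : X p k) (y : Y q k),
    bm_fun p q k (pact X g k x) (pact Y h k y) =
    pact Z (perm_sum g h) k (bm_fun p q k x y);
  bm_sigmal : forall p q k (s : S1 k) (x : X p k) (y : Y q k),
    bm_fun p.+1 q k (sigma X k s x) y = sigma Z k s (bm_fun p q k x y);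
  bm_sigmar : forall p q k (s : S1 k) (x : X p k) (y : Y q k),
    lev_cast (addnS p q) (bm_fun p q.+1 k x (sigma Y k s y)) =
    pact Z (lift_perm ord0 (inord p) 1%g) k (sigma Z k s (bm_fun p q k x y))
}.

Definition is_smash_product (X Y Z : spectrum) (b : bilinear X Y Z) : Prop :=
  forall (W : spectrum) (c : bilinear X Y W), exists f : spmap Z W,
    (forall p q k (x : X p k) (y : Y q k), f (p + q) k (b p q k x y) = c p q k x y)
 /\ (forall f' : spmap Z W,
      (forall p q k (x : X p k) (y : Y q k),
         f' (p + q) k (b p q k x y) = c p q k x y) -> f' = f).

(* [h] is [f /\ g]. *)
Definition is_smash_map (X X' Y Y' Z Z' : spectrum) (b : bilinear X Y Z)
  (b' : bilinear X' Y' Z') (f : spmap X X') (g : spmap Y Y') (h : spmap Z Z') :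
  Prop :=
  forall p q k (x : X p k) (y : Y q k),
    h (p + q) k (b p q k x y) = b' p q k (f p k x) (g q k y).

Definition level_equivalence (X Y : spectrum) (f : spmap X Y) : Prop :=
  forall n, ss_weq (f n).

Definition injective_ps (K L : psset) (f : psmap K L) : Prop :=
  forall k, injective (f k : K k -> L k).

Definition monomorphism (X Y : spectrum) (f : spmap X Y) : Prop :=
  forall n, injective_ps (f n).

Definition injective_spectrum (E : spectrum) : Prop :=
  forall (X Y : spectrum) (i : spmap X Y),
  monomorphism i -> level_equivalence i ->
  forall f : spmap X E, exists g : spmap Y E, sp_comp g i = f.

Definition Omega_spectrum (E : spectrum) : Prop :=
  forall n, kan (E n) /\ ss_weq (adjoint_map (sigma E (n := n))).

Definition sp_homotopy (X E : spectrum) (f g : spmap X E) : Prop :=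
  exists H : spmap (tensor (plus (Delta 1)) X) E, forall n k (x : X n k),
    let pt (i : 'I_2) : smash (plus (Delta 1)) (X n) k :=
      cls _ (cls _ (simplex_const k i), x) in
    H n k (pt ord0) = f n k x /\ H n k (pt ord_max) = g n k x.

Definition sp_homotopic (X E : spectrum) (f g : spmap X E) : Prop :=
  clos_refl_sym_trans (spmap X E) (@sp_homotopy X E) f g.

(* [f] induces a bijection [E^0 Y -> E^0 X] for every injective Omega-spectrum
   [E], where [E^0 X] is the set of components of [Map(X, E)]. *)
Definition stable_equivalence : morph_class Sp :=
  fun (X Y : spectrum) (f : spmap X Y) =>
  forall E : spectrum, injective_spectrum E -> Omega_spectrum E ->
    (forall h : spmap X E, exists g : spmap Y E, sp_homotopic (sp_comp g f) h)
 /\ (forall g g' : spmap Y E,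
       sp_homotopic (sp_comp g f) (sp_comp g' f) -> sp_homotopic g g').

(* The pushout-product axioms: the corner map of two cofibrations is a
   cofibration, which is acyclic if one of the two is. *)
Definition smash_compatible (M : model_structure Sp) : Prop :=
  forall (X X' Y Y' : spectrum) (f : spmap X X') (g : spmap Y Y'),
  cof M (f : hom (c := Sp) X X') -> cof M (g : hom (c := Sp) Y Y') ->
  forall (A B C D : spectrum) (bA : bilinear X Y A) (bB : bilinear X' Y B)
    (bC : bilinear X Y' C) (bD : bilinear X' Y' D)
    (u : spmap A B) (v : spmap A C) (v' : spmap B D) (u' : spmap C D),
  is_smash_product bA -> is_smash_product bB ->
  is_smash_product bC -> is_smash_product bD ->
  is_smash_map bA bB f (sp_id Y) u -> is_smash_map bA bC (sp_id X) g v ->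
  is_smash_map bB bD (sp_id X') g v' -> is_smash_map bC bD f (sp_id Y') u' ->
  corner_map_in (C := Sp) (@cof Sp M) u v v' u' /\
  (weq M (f : hom (c := Sp) X X') \/ weq M (g : hom (c := Sp) Y Y') ->
   corner_map_in (C := Sp) (@weq Sp M) u v v' u').

Definition tensor_compatible (M : model_structure Sp) : Prop :=
  forall (K L : psset) (f : psmap K L) (X Y : spectrum) (g : spmap X Y),
  injective_ps f -> cof M (g : hom (c := Sp) X Y) ->
  let u : hom (c := Sp) (tensor K X) (tensor L X) := tensor_map f (sp_id X) in
  let v : hom (c := Sp) (tensor K X) (tensor K Y) := tensor_map (ps_id K) g in
  let v' : hom (c := Sp) (tensor L X) (tensor L Y) := tensor_map (ps_id L) g in
  let u' : hom (c := Sp) (tensor K Y) (tensor L Y) := tensor_map f (sp_id Y) in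
  corner_map_in (@cof Sp M) u v v' u' /\
  (ss_weq f \/ weq M (g : hom (c := Sp) X Y) ->
   corner_map_in (@weq Sp M) u v v' u').

(* A model structure for stable homotopy theory, compatible with the smash
   product and with the tensoring over based simplicial sets, in which the
   sphere spectrum is cofibrant. The stable model structures of Hovey, Shipley
   and Smith with projective cofibrations and with S-cofibrations are both of
   this kind. *)
Record stable_model_structure (M : model_structure Sp) : Prop := {
  stable_weq : forall (X Y : Sp) (f : hom X Y), weq M f <-> stable_equivalence f;
  stable_smash : smash_compatible M;
  stable_tensor : tensor_compatible M;
  stable_unit : cofibrant M (sphere : Sp)
}.

(* By [sq_actM], permutations act contravariantly under composition, as they do
   for a functor on [Epi^op]. *)
Record symseq := SymSeq {
  sq_lev :> nat -> spectrum;
  sq_act : forall n, 'S_n -> spmap (sq_lev n) (sq_lev n);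
  sq_act1 : forall n, sq_act (1%g : 'S_n) = sp_id (sq_lev n);
  sq_actM : forall n (g h : 'S_n),
    sq_act (g * h)%g = sp_comp (sq_act g) (sq_act h)
}.
Arguments sq_act M {n} : rename.

Record sqmap (M N : symseq) := SqMap {
  sq_fun :> forall n, spmap (M n) (N n);
  sq_equiv : forall n (g : 'S_n),
    sp_comp (sq_fun n) (sq_act M g) = sp_comp (sq_act N g) (sq_fun n)
}.

Lemma sqmap_eq (M N : symseq) (f g : sqmap M N) :
  (forall n, f n = g n) -> f = g.
Proof.
case: f g => [f hf] [g hg] /= efg.
have e : f = g by exact: functional_extensionality_dep.
by case: _ / e hg {efg} => hg; congr SqMap; apply: Prop_irrelevance.
Qed.

Definition sq_id (M : symseq) : sqmap M M.
Proof.
by refine (@SqMap M M (fun n => sp_id (M n)) _) => n g; apply: spmap_eq.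
Defined.

Definition sq_comp (M N P : symseq) (g : sqmap N P) (f : sqmap M N) : sqmap M P.
Proof.
refine (@SqMap M P (fun n => sp_comp (g n) (f n)) _) => n h.
by rewrite -sp_compA (sq_equiv f) !sp_compA (sq_equiv g).
Defined.

Definition SymSp : category.
Proof.
refine (@Category symseq sqmap sq_id sq_comp _ _ _);
  by move=> *; apply: sqmap_eq => n; apply: spmap_eq.
Defined.

Definition levelwise (P : morph_class Sp) : morph_class SymSp :=
  fun (M N : symseq) (f : sqmap M N) => forall n, P (M n) (N n) (f n).

Definition levelwise_model_structure (MSp : model_structure Sp)
    (MSym : model_structure SymSp) : Prop :=
  forall (M N : SymSp) (f : hom M N),
    (weq MSym f <-> levelwise (@weq Sp MSp) f) /\
    (cof MSym f <-> levelwise (@cof Sp MSp) f).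

Record surj (r n : nat) := Surj {
  sj_fun :> 'I_r -> 'I_n;
  sj_surj : forall j, exists i, sj_fun i = j
}.

Lemma surj_eq r n (f g : surj r n) : f =1 g -> f = g.
Proof.
case: f g => [f hf] [g hg] /= /funext efg; case: _ / efg hg => hg.
by congr Surj; apply: Prop_irrelevance.
Qed.

Definition surj_comp r n m (f : surj n m) (g : surj r n) : surj r m.
Proof.
refine (@Surj r m (fun i => f (g i)) _) => j.
by have [i <-] := sj_surj f j; have [l <-] := sj_surj g i; exists l.
Defined.

Definition surj_perm n (s : 'S_n) : surj n n :=
  @Surj n n s (fun j => ex_intro _ _ (permKV s j)).

Definition surj_id n : surj n n :=
  @Surj n n id (fun j => ex_intro _ j erefl).

(* Right Com-modules as functors [Epi^op -> Sp]. The object 0 is included; as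
   its only morphism is the identity, this amounts to the value [M(0)]. *)
Record rmod := RMod {
  rm_lev :> nat -> spectrum;
  rm_act : forall r n, surj r n -> spmap (rm_lev n) (rm_lev r);
  rm_act1 : forall n, rm_act (surj_id n) = sp_id (rm_lev n);
  rm_actM : forall r n m (f : surj n m) (g : surj r n),
    rm_act (surj_comp f g) = sp_comp (rm_act g) (rm_act f);
  rm_zero : forall m k (x : rm_lev 0 m k), x = bpt
}.
Arguments rm_act M {r n} : rename.

Record rmmap (M N : rmod) := RMMap {
  rm_fun :> forall n, spmap (M n) (N n);
  rm_nat : forall r n (f : surj r n),
    sp_comp (rm_fun r) (rm_act M f) = sp_comp (rm_act N f) (rm_fun n)
}.

Lemma rmmap_eq (M N : rmod) (f g : rmmap M N) : (forall n, f n = g n) -> f = g.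
Proof.
case: f g => [f hf] [g hg] /= efg.
have e : f = g by exact: functional_extensionality_dep.
by case: _ / e hg {efg} => hg; congr RMMap; apply: Prop_irrelevance.
Qed.

Definition rm_id (M : rmod) : rmmap M M.
Proof.
by refine (@RMMap M M (fun n => sp_id (M n)) _) => r n f; apply: spmap_eq.
Defined.

Definition rm_comp (M N P : rmod) (g : rmmap N P) (f : rmmap M N) : rmmap M P.
Proof.
refine (@RMMap M P (fun n => sp_comp (g n) (f n)) _) => r n h.
by rewrite -sp_compA (rm_nat f) !sp_compA (rm_nat g).
Defined.

Definition RModCom : category.
Proof.
refine (@Category rmod rmmap rm_id rm_comp _ _ _);
  by move=> *; apply: rmmap_eq => n; apply: spmap_eq.
Defined.

Definition underlying (M : rmod) : symseq.
Proof.
refine (@SymSeq M (fun n s => rm_act M (surj_perm s)) _ _).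
- move=> n; rewrite -rm_act1; congr rm_act.
  by apply: surj_eq => i /=; rewrite perm1.
- move=> n g h; rewrite -rm_actM; congr rm_act.
  by apply: surj_eq => i /=; rewrite permM.
Defined.

Definition underlying_map (M N : rmod) (f : rmmap M N) :
  sqmap (underlying M) (underlying N) :=
  @SqMap (underlying M) (underlying N) f (fun n s => rm_nat f (surj_perm s)).

Definition created_model_structure (MSym : model_structure SymSp)
    (MMod : model_structure RModCom) : Prop :=
  forall (M N : RModCom) (f : hom M N),
    (weq MMod f <-> weq MSym (underlying_map f : hom (c := SymSp) _ _)) /\
    (fib MMod f <-> fib MSym (underlying_map f : hom (c := SymSp) _ _)).

Definition diagonal (K : psset) (r n : nat) (f : surj r n) :
  psmap (smash_pow K n) (smash_pow K r).
Proof.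
unshelve refine (@quot_map (pow_sset K n) (pow_sset K r) _ _ _ _
  (@SSMap (pow_sset K n) (pow_sset K r) (fun k x i => x (f i)) _) _).
- by [].
- by move=> k x [j xj]; have [i fi] := sj_surj f j; exists i; rewrite /= fi.
Defined.

Definition tensor_com_lev (K : psset) (n : nat) : spectrum :=
  if n is 0 then zero_spectrum else tensor (smash_pow K n) sphere.

Definition tensor_com_act (K : psset) (r n : nat) :
  surj r n -> spmap (tensor_com_lev K n) (tensor_com_lev K r) :=
  match n, r with
  | n'.+1, r'.+1 => fun f => tensor_map (diagonal K f) (sp_id sphere)
  | _, _ => fun _ => zero_map _ _
  end.

Lemma diagonalE (K : psset) r n (f : surj r n) k (x : 'I_n -> K k) :
  diagonal K f k (cls (fun x => exists i, x i = bpt) x) =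
  cls (fun x => exists i, x i = bpt) (fun i => x (f i)).
Proof.
rewrite /= collapse_recE // => -[j xj]; apply: cls_None.
by have [i fi] := sj_surj f j; exists i; rewrite /= fi.
Qed.

Definition tensor_com (K : psset) : rmod.
Proof.
refine (@RMod (tensor_com_lev K) (@tensor_com_act K) _ _ _).
- case=> [|n]; apply: spmap_eq => m k; first by case.
  apply: collapse_case => // -[a x] _; rewrite smash_mapE /=.
  congr cls; congr pair; elim/collapse_case: a => // y _.
  exact: (diagonalE (surj_id n.+1)).
- move=> [|r] [|n] [|m] f g; apply: spmap_eq => l k.
  + by [].
  + by move=> x; have [[]] := sj_surj f ord0.
  + by have [[]] := sj_surj g ord0.
  + by have [[]] := sj_surj g ord0.
  + by [].
  + by case: (g ord0).
  + by case: (f ord0).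
  + apply: collapse_case => // -[a x] _.
    rewrite -[RHS]/(smash_map (diagonal K g) (ps_id (sphere l)) k
      (smash_map (diagonal K f) (ps_id (sphere l)) k (cls _ (a, x)))).
    rewrite !smash_mapE; congr cls; congr pair.
    elim/collapse_case: a => // y _.
    by rewrite !diagonalE.
- by move=> m k [].
Defined.

(* Main.v *)
From mathcomp Require Import all_boot all_fingroup.
From mathcomp Require Import boolp.
Require Import Defs.

(* By the retract argument it suffices to find a section of every acyclic
   fibration [g : X -> K (x) Com] of right [Com]-modules. The section is built
   by induction on the arity. In arity [N + 1] its values are forced on
   [D /\ S], where [D] in [K^(N+1)] is the fat diagonal, that is, the union of
   the images of the diagonals of noninvertible surjections: two presentations
   [f^* b = f'^* b'] of a simplex off the basepoint factor through a common
   [c], so the forced values agree. As cofibrations of symmetric sequences are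
   detected on underlying spectra, the inclusion of [D /\ S] into
   [K^(N+1) /\ S] (concentrated in arity [N + 1]) is a cofibration of symmetric
   sequences, by the pushout-product axiom applied to [D -> K^(N+1)] and
   [0 -> S]; hence the equivariant extension to [K^(N+1) /\ S] exists. *)

Set Implicit Arguments.
Unset Strict Implicit.
Unset Printing Implicit Defensive.

(** * Simplices of tensors and maps out of them *)

Lemma cls_inj (T : Type) (L : T -> Prop) (x y : T) :
  ~ L x -> cls L x = cls L y -> x = y.
Proof. by rewrite /cls; case: pselect => // hx _; case: pselect => // hy [->]. Qed.

Section TensorElements.
Variables (K : psset) (X : spectrum).

Definition tens n k (a : K k) (x : X n k) : tensor K X n k :=
  cls (fun z => z.1 = bpt \/ z.2 = bpt) (a, x).

Lemma tens_bptl n k (x : X n k) : tens bpt x = bpt.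
Proof. by apply: cls_None; left. Qed.

Lemma tens_bptr n k (a : K k) : tens a (bpt : X n k) = bpt.
Proof. by apply: cls_None; right. Qed.

Lemma tensP n k (t : tensor K X n k) : exists a x, t = tens a x.
Proof.
elim/collapse_case: t => [|[a x] _]; last by exists a, x.
by exists bpt, bpt; rewrite tens_bptl.
Qed.

Lemma tens_act n m k (f : simplex_map m k) (a : K k) (x : X n k) :
  sact f (tens a x) = tens (sact f a) (sact f x).
Proof.
rewrite /tens /= collapse_recE //= => h; apply: cls_None.
by case: h => /= ->; rewrite bpt_act; [left|right].
Qed.

Lemma tens_pact n (g : 'S_n) k (a : K k) (x : X n k) :
  pact (tensor K X) g k (tens a x) = tens a (pact X g k x).
Proof. exact: tensor_pactE. Qed.

Lemma tens_sigma n k (s : S1 k) (a : K k) (x : X n k) :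
  sigma (tensor K X) k s (tens a x) = tens a (sigma X k s x).
Proof. exact: (@iter_tensor_sigma K X 1 n k (fun=> s)). Qed.

Variables (Z : spectrum) (F : forall n, bimap K (X n) (Z n)).
Hypothesis F_pact : forall n (g : 'S_n) k (a : K k) (x : X n k),
  F n k a (pact X g k x) = pact Z g k (F n k a x).
Hypothesis F_sigma : forall n k (s : S1 k) (a : K k) (x : X n k),
  F n.+1 k a (sigma X k s x) = sigma Z k s (F n k a x).

Let fn n k : tensor K X n k -> Z n k :=
  collapse_rec (fun z => F n k z.1 z.2) bpt.

Let fnE n k (a : K k) (x : X n k) : fn (tens a x) = F n k a x.
Proof.
by rewrite /fn /tens collapse_recE //= => -[] ->; rewrite ?bi_ptl ?bi_ptr.
Qed.

Definition tensor_rec : spmap (tensor K X) Z.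
Proof.
unshelve refine (@SpMap (tensor K X) Z (fun n => @PSMap (tensor K X n) (Z n)
  (@SSMap (tensor K X n) (Z n) (@fn n) _) _) _ _).
- by move=> m k f t; have [a [x ->]] := tensP t; rewrite tens_act !fnE bi_nat.
- by [].
- move=> n g k t; have [a [x ->]] := tensP t.
  by rewrite tens_pact; rewrite /= !fnE F_pact.
- move=> n k s t; have [a [x ->]] := tensP t.
  by rewrite tens_sigma; rewrite /= !fnE F_sigma.
Defined.

Lemma tensor_recE n k (a : K k) (x : X n k) : tensor_rec n k (tens a x) = F n k a x.
Proof. exact: fnE. Qed.

End TensorElements.

Lemma tensor_mapE (K L : psset) (X Y : spectrum) (f : psmap K L) (g : spmap X Y)
    n k (a : K k) (x : X n k) :
  tensor_map f g n k (tens a x) = tens (f k a) (g n k x).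
Proof. exact: smash_mapE. Qed.

Lemma tensor_spmap_eq (K : psset) (X Z : spectrum) (f g : spmap (tensor K X) Z) :
  (forall n k (a : K k) (x : X n k), f n k (tens a x) = g n k (tens a x)) -> f = g.
Proof.
by move=> fg; apply: spmap_eq => n k t; have [a [x ->]] := tensP t.
Qed.

Lemma spmap_bpt (X Y : spectrum) (f : spmap X Y) n k : f n k bpt = bpt.
Proof. exact: ps_bpt. Qed.

Lemma sp_compE (X Y Z : spectrum) (g : spmap Y Z) (f : spmap X Y) n k (x : X n k) :
  sp_comp g f n k x = g n k (f n k x).
Proof. by []. Qed.

(** * Cofibrations from injections tensored with the sphere *)

(** The identity and the zero map are both endomorphisms of [E], hence equal. *)
Lemma initial_spectrum_trivial (E : Sp) :
  is_initial E -> forall n k (x : (E : spectrum) n k), x = bpt.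
Proof.
move=> /(_ E)[f fE] n k x.
by rewrite -[LHS]/(sp_id E n k x) (fE (sp_id E)) -(fE (zero_map E E)).
Qed.

(* Pushout-product of [K -> L] with [0 -> S], where tensors with [0] vanish. *)
Lemma cof_tensor_sphere (MSp : model_structure Sp)
    (hSp : stable_model_structure MSp) (K L : psset) (f : psmap K L) :
  injective_ps f ->
  cof MSp (tensor_map f (sp_id sphere) :
             hom (c := Sp) (tensor K sphere) (tensor L sphere)).
Proof.
move=> finj; have [E [e [E0 ecof]]] := stable_unit hSp.
have trivE := initial_spectrum_trivial E0.
have [] := stable_tensor hSp finj ecof.
move=> + _; apply; first last.
- exact: (compm1 (c := Sp)).
(* As the tensors with [E] are trivial, [K /\ S] itself is the pushout, with [j] the identity and
   [i] zero, and the corner map is [f /\ S]. *)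
- instantiate (1 := (zero_map (tensor L E) (tensor K sphere) : hom (c := Sp) _ _)).
  apply: tensor_spmap_eq => n k a x.
  by rewrite (trivE n k x) tens_bptr !spmap_bpt.
split.
  apply: tensor_spmap_eq => n k a x.
  by rewrite (trivE n k x) tens_bptr !spmap_bpt.
move=> D i' j' ij; exists j'; split.
- apply: tensor_spmap_eq => n k a x.
  by rewrite (trivE n k x) tens_bptr !spmap_bpt.
- exact: (compm1 (c := Sp)).
- by move=> h' _ <-; rewrite (compm1 (c := Sp)).
Qed.
Local Opaque tensor_map sp_comp.

(** * Surjections of finite sets *)

Lemma surj_leq r n (f : surj r n) : n <= r.
Proof.
pose g j := sval (cid (sj_surj f j)).
have gK : cancel g f by move=> j; exact: svalP (cid (sj_surj f j)).
by have := leq_card g (can_inj gK); rewrite !card_ord.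
Qed.

(** A chosen right inverse of [f] is injective, hence bijective by finiteness, so [f] is
    injective. *)
Lemma surj_permP n (f : surj n n) : exists s : 'S_n, f = surj_perm s.
Proof.
have fI : injective f.
  pose g j := sval (cid (sj_surj f j)).
  have gK : cancel g f by move=> j; exact: svalP (cid (sj_surj f j)).
  have [h hK Kh] := injF_bij (can_inj gK).
  apply: (can_inj (g := g)) => i.
  by rewrite -[i in f i]Kh gK Kh.
by exists (perm fI); apply: surj_eq => i /=; rewrite permE.
Qed.

(** The image of [y] is listed without repetition, using classical decidable equality on [T]; [f]
    sends an index to the position of its value. *)
Lemma image_factorization (T : Type) n (y : 'I_n -> T) :
  exists e (f : surj n e) (z : 'I_e -> T), injective z /\ y = z \o f.
Proof.
pose s := undup [seq (y i : {classic T}) | i : 'I_n].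
have ys i : (y i : {classic T}) \in s by rewrite mem_undup map_f ?mem_enum.
have fP i : index (y i : {classic T}) s < size s by rewrite index_mem.
have fS (j : 'I_(size s)) : exists i, Ordinal (fP i) = j.
  have : tnth (in_tuple s) j \in s by exact: mem_tnth.
  rewrite mem_undup => /mapP[i _ e]; exists i; apply: val_inj => /=.
  by rewrite -e (tnth_nth (y i : {classic T})) /= index_uniq ?undup_uniq.
have zI : injective (tnth (in_tuple s)).
  by apply/tuple_uniqP; exact: undup_uniq.
exists (size s), (Surj fS), (tnth (in_tuple s)); split.
  exact: zI.
apply: funext => i; rewrite /= (tnth_nth (y i : {classic T})) /=.
by rewrite nth_index.
Qed.

(** By surjectivity of [f] and [f'], the tuples [y] and [y'] have the same image; [z] enumerates it,
    and both tuples factor through [z]. *)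
Lemma surj_span (T : Type) r n n' (f : surj r n) (f' : surj r n')
    (y : 'I_n -> T) (y' : 'I_n' -> T) : y \o f = y' \o f' ->
  exists e (g : surj n e) (g' : surj n' e) (z : 'I_e -> T),
    [/\ surj_comp g f = surj_comp g' f', y = z \o g & y' = z \o g'].
Proof.
move=> /funeqP yy'; have [e [g [z [zI yE]]]] := image_factorization y.
(* The map [g'] is [g \o f \o c] for a chosen section [c] of [f']; injectivity of [z] makes it
   independent of the choice. *)
pose c j := sval (cid (sj_surj f' j)).
have cK : cancel c f' by move=> j; exact: svalP (cid (sj_surj f' j)).
have zc j : z (g (f (c j))) = y' j.
  by rewrite -[in RHS](cK j) -[RHS]yy' /= yE.
have gf' i : g (f (c (f' i))) = g (f i).
  by apply: zI; rewrite zc -[LHS]yy' /= yE.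
have sS : forall l, exists j, g (f (c j)) = l.
  move=> l; have [j <-] := sj_surj g l; have [i <-] := sj_surj f j.
  by exists (f' i).
exists e, g, (@Surj _ _ (fun j => g (f (c j))) sS), z; split=> //.
- by apply: surj_eq => i /=.
- by apply: funext => j /=; rewrite zc.
Qed.

(** * Diagonals of smash powers and simplices of [K (x) Com] *)

Section Diagonal.
Variable K : psset.

Lemma diagonal_id n k (a : smash_pow K n k) : diagonal K (surj_id n) k a = a.
Proof. by elim/collapse_case: a => // x _; rewrite diagonalE. Qed.

Lemma diagonal_comp r n m (f : surj n m) (g : surj r n) k (a : smash_pow K m k) :
  diagonal K (surj_comp f g) k a = diagonal K g k (diagonal K f k a).
Proof. by elim/collapse_case: a => // x _; rewrite !diagonalE. Qed.

Lemma diagonal_bptP r n (f : surj r n) k (a : smash_pow K n k) :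
  diagonal K f k a = bpt -> a = bpt.
Proof.
elim/collapse_case: a => // x hx; rewrite diagonalE.
by rewrite /cls; case: pselect => // -[i xi]; case: hx; exists (f i).
Qed.

(** Off the basepoint, equal simplices of a smash power are represented by equal tuples, so
    [surj_span] applies. *)
Lemma diagonal_span r n n' (f : surj r n) (f' : surj r n') k
    (a : smash_pow K n k) (a' : smash_pow K n' k) :
  diagonal K f k a = diagonal K f' k a' -> a <> bpt ->
  exists e (g : surj n e) (g' : surj n' e) b,
    [/\ surj_comp g f = surj_comp g' f', a = diagonal K g k b
      & a' = diagonal K g' k b].
Proof.
elim/collapse_case: a => // y hy; elim/collapse_case: a' => [+ _|y' hy'].
  by rewrite ps_bpt => /diagonal_bptP; rewrite /cls; case: pselect.
rewrite !diagonalE => yy' _.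
have /surj_span[e [g [g' [z [gg -> ->]]]]] : y \o f = y' \o f'.
  by apply: cls_inj yy' => -[i xi]; apply: hy; exists (f i).
by exists e, g, g', (cls _ z); split; rewrite ?diagonalE.
Qed.

(* Every simplex of [(K (x) Com)(n)] has this form, also in arity 0, where
   [smash_pow K 0] is [S^0] but the spectrum is a point. *)
Definition tens_com n m k : smash_pow K n k -> sphere m k ->
    tensor_com_lev K n m k :=
  match n with 0 => fun _ _ => tt | n'.+1 => @tens _ _ _ _ end.

Lemma tens_comP n m k (t : tensor_com_lev K n m k) :
  exists a s, t = tens_com a s.
Proof.
by case: n t => [[]|n t]; [exists bpt, bpt | exact: tensP].
Qed.

Lemma tens_com_bptl n m k (s : sphere m k) :
  tens_com (bpt : smash_pow K n k) s = bpt.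
Proof. by case: n => // n; exact: tens_bptl. Qed.

Lemma tens_com_bptr n m k (a : smash_pow K n k) :
  tens_com a (bpt : sphere m k) = bpt.
Proof. by case: n a => // n a; exact: tens_bptr. Qed.

Lemma tens_com_act n m k l (f : simplex_map l k) (a : smash_pow K n k)
    (s : sphere m k) :
  sact f (tens_com a s) = tens_com (sact f a) (sact f s).
Proof. by case: n a => // n a; exact: tens_act. Qed.

Lemma tens_com_pact n m (g : 'S_m) k (a : smash_pow K n k) (s : sphere m k) :
  pact (tensor_com_lev K n) g k (tens_com a s) = tens_com a (pact sphere g k s).
Proof. by case: n a => // n a; exact: tens_pact. Qed.

Lemma tens_com_sigma n m k (u : S1 k) (a : smash_pow K n k) (s : sphere m k) :
  sigma (tensor_com_lev K n) k u (tens_com a s) = tens_com a (sigma sphere k u s).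
Proof. by case: n a => // n a; exact: tens_sigma. Qed.

Lemma tens_com_diagonal r n (f : surj r n) m k (a : smash_pow K n k)
    (s : sphere m k) :
  rm_act (tensor_com K) f m k (tens_com a s) = tens_com (diagonal K f k a) s.
Proof.
case: n r f a => [|n] [|r] f a.
- by [].
- by exfalso; case: (f ord0).
- by exfalso; have := surj_leq f; rewrite ltn0.
- exact: tensor_mapE.
Qed.

End Diagonal.

(** * Symmetric sequences of subcomplexes of smash powers *)

(* Families of based subcomplexes of the [K^n], stable under permutations. *)
Record pow_family (K : psset) := PowFamily {
  pf_in :> forall n k, smash_pow K n k -> Prop;
  pf_sub : forall n, subcomplex (@pf_in n);
  pf_bpt : forall n k, pf_in (bpt : smash_pow K n k);
  pf_perm : forall n (s : 'S_n) k (a : smash_pow K n k),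
    pf_in a -> pf_in (diagonal K (surj_perm s) k a)
}.
Arguments pf_in {K} p n k a.

Section PowFamily.
Variables (K : psset) (P : pow_family K).

Definition pf_psset (n : nat) : psset.
Proof.
refine (@PSSet (sub_sset (@pf_sub K P n))
  (fun k => exist _ (bpt : smash_pow K n k) (pf_bpt P n k)) _).
by move=> m k f; apply: eq_exist; exact: bpt_act.
Defined.

Definition pf_act n (s : 'S_n) : psmap (pf_psset n) (pf_psset n).
Proof.
unshelve refine (@PSMap (pf_psset n) (pf_psset n) (@SSMap (pf_psset n) (pf_psset n)
  (fun k a => exist (P n k) (diagonal K (surj_perm s) k (sval a))
     (pf_perm s (svalP a))) _) _).
- by move=> m k f a; apply: eq_exist; exact: ss_nat.
- by move=> k; apply: eq_exist; exact: ps_bpt.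
Defined.

Definition pf_symseq : symseq.
Proof.
refine (@SymSeq (fun n => tensor (pf_psset n) sphere)
  (fun n s => tensor_map (pf_act s) (sp_id sphere)) _ _).
- move=> n; apply: tensor_spmap_eq => m k [a ha] s; rewrite tensor_mapE.
  congr tens; apply: eq_exist; rewrite -[RHS]diagonal_id; congr (diagonal K _ k a).
  by apply: surj_eq => i; rewrite /= perm1.
- move=> n g h; apply: tensor_spmap_eq => m k [a ha] s.
  rewrite [RHS]sp_compE [LHS]tensor_mapE.
  rewrite [X in _ = tensor_map _ _ _ _ X]tensor_mapE [RHS]tensor_mapE.
  congr tens; apply: eq_exist; apply: etrans (diagonal_comp _ _ _).
  congr (diagonal K _ k a).
  by apply: surj_eq => i; rewrite /= permM.
Defined.

End PowFamily.

Section Inclusion.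
Variables (K : psset) (P Q : pow_family K).
Hypothesis PQ : forall n k a, P n k a -> Q n k a.

Definition pf_incl_psmap (n : nat) : psmap (pf_psset P n) (pf_psset Q n).
Proof.
unshelve refine (@PSMap (pf_psset P n) (pf_psset Q n)
  (@SSMap (pf_psset P n) (pf_psset Q n)
    (fun k a => exist (Q n k) (sval a) (PQ (svalP a))) _) _).
- by move=> m k f a; apply: eq_exist.
- by move=> k; apply: eq_exist.
Defined.

Definition pf_incl : sqmap (pf_symseq P) (pf_symseq Q).
Proof.
refine (@SqMap (pf_symseq P) (pf_symseq Q)
  (fun n => tensor_map (pf_incl_psmap n) (sp_id sphere)) _).
move=> n g; apply: tensor_spmap_eq => m k a s.
rewrite [LHS]sp_compE [RHS]sp_compE.
rewrite [X in tensor_map _ _ _ _ X = _]tensor_mapE [LHS]tensor_mapE.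
rewrite [X in _ = tensor_map _ _ _ _ X]tensor_mapE [RHS]tensor_mapE.
by congr tens; apply: eq_exist.
Defined.

Lemma pf_incl_inj n : injective_ps (pf_incl_psmap n).
Proof.
by move=> k [a ha] [b hb] [ab]; apply: eq_exist.
Qed.

End Inclusion.

(** * Equations between maps, evaluated on simplices *)

Lemma spmap_eqE (X Y : spectrum) (f g : spmap X Y) :
  f = g -> forall n k (x : X n k), f n k x = g n k x.
Proof. by move=> ->. Qed.

Lemma sqmap_eqE (M N : symseq) (f g : sqmap M N) :
  f = g -> forall n m k (x : M n m k), f n m k x = g n m k x.
Proof. by move=> ->. Qed.

Lemma rm_actE (M : rmod) r n l (f : surj n l) (g : surj r n) m k (x : M l m k) :
  rm_act M (surj_comp f g) m k x = rm_act M g m k (rm_act M f m k x).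
Proof. by rewrite rm_actM. Qed.

Lemma rm_natE (M N : rmod) (u : rmmap M N) r n (f : surj r n) m k (x : M n m k) :
  u r m k (rm_act M f m k x) = rm_act N f m k (u n m k x).
Proof. by have := spmap_eqE (rm_nat u f) x; rewrite [LHS]sp_compE => ->. Qed.

(** * Maps from the subcomplexes to [K (x) Com] *)

Section ToTensorCom.
Variables (K : psset) (P : pow_family K).

Definition pf_to_bimap n m :
  bimap (pf_psset P n) (sphere m) (tensor_com_lev K n m).
Proof.
refine (@BiMap (pf_psset P n) (sphere m) (tensor_com_lev K n m)
  (fun k a s => tens_com (sval a) s) _ _ _).
- by move=> l k f a s; rewrite tens_com_act.
- by move=> k s; exact: tens_com_bptl.
- by move=> k a; exact: tens_com_bptr.
Defined.

Definition pf_to_com_lev n : spmap (tensor (pf_psset P n) sphere) (tensor_com_lev K n).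
Proof.
apply: (@tensor_rec _ _ _ (pf_to_bimap n)).
- by move=> m g k a s; rewrite /= tens_com_pact.
- by move=> m k u a s; rewrite /= tens_com_sigma.
Defined.

Lemma pf_to_com_levE n m k (a : pf_psset P n k) (s : sphere m k) :
  pf_to_com_lev n m k (tens a s) = tens_com (sval a) s.
Proof. exact: tensor_recE. Qed.

Definition pf_to_com : sqmap (pf_symseq P) (underlying (tensor_com K)).
Proof.
refine (@SqMap (pf_symseq P) (underlying (tensor_com K)) pf_to_com_lev _).
move=> n g; apply: tensor_spmap_eq => m k a s.
rewrite [LHS]sp_compE [RHS]sp_compE [X in _ = _ X]pf_to_com_levE.
rewrite [RHS]tens_com_diagonal [X in _ X = _]tensor_mapE.
exact: pf_to_com_levE.
Defined.

End ToTensorCom.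

(** * Extending a partial section by one arity *)

Section PartialSections.
Variables (K : psset) (X : rmod) (g : rmmap X (tensor_com K)).

(** The family [h] is total, but unconstrained above arity [N]; in the second clause [n <= r <= N]
    by surjectivity of [f]. *)
Definition partial_section (N : nat)
    (h : forall n, spmap (tensor_com_lev K n) (X n)) : Prop :=
  (forall n m k (a : smash_pow K n k) (s : sphere m k), n <= N ->
    g n m k (h n m k (tens_com a s)) = tens_com a s) /\
  (forall r n (f : surj r n) m k (a : smash_pow K n k) (s : sphere m k), r <= N ->
    h r m k (tens_com (diagonal K f k a) s) =
    rm_act X f m k (h n m k (tens_com a s))).

Section Step.
Variables (N : nat) (h : forall n, spmap (tensor_com_lev K n) (X n)).
Hypothesis hN : partial_section N h.

(* The fat diagonal in arity [N + 1] and the basepoint in all other arities;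
   stating the arity condition as a proposition avoids casts between arities. *)
Definition degenerate n k (a : smash_pow K n k) : Prop :=
  a = bpt \/ n = N.+1 /\ exists e (f : surj n e) (b : smash_pow K e k),
    e <= N /\ a = diagonal K f k b.

Definition degenerate_family : pow_family K.
Proof.
refine (@PowFamily K degenerate _ _ _).
- move=> n l k f a [->|[nN [e [u [b [eN ->]]]]]]; first by left; rewrite bpt_act.
  by right; split=> //; exists e, u, (sact f b); rewrite ss_nat.
- by move=> n k; left.
- move=> n s k a [->|[nN [e [u [b [eN ->]]]]]]; first by left; rewrite ps_bpt.
  by right; split=> //; exists e, (surj_comp u (surj_perm s)), b; rewrite diagonal_comp.
Defined.

Definition level_family : pow_family K.
Proof.
refine (@PowFamily K (fun n k a => a = bpt \/ n = N.+1) _ _ _).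
- by move=> n l k f a [->|]; [left; rewrite bpt_act | right].
- by move=> n k; left.
- by move=> n s k a [->|]; [left; rewrite ps_bpt | right].
Defined.

Lemma degenerate_level n k a :
  degenerate_family n k a -> level_family n k a.
Proof. by case=> [|[]]; [left|right]. Qed.

(** Quantifying over all presentations of [a] lets later identities use whichever presentation is at
    hand. *)
Definition forced_value n m k (a : smash_pow K n k) (s : sphere m k) (w : X n m k) :=
  (a = bpt -> w = bpt) /\
  forall e (f : surj n e) (b : smash_pow K e k), e <= N ->
    a = diagonal K f k b -> w = rm_act X f m k (h e m k (tens_com b s)).

Lemma forced_value_ex n m k (a : smash_pow K n k) (s : sphere m k) :
  degenerate a -> exists w : X n m k, forced_value a s w.
Proof.
move=> da; case: (pselect (a = bpt)) => [->|a0].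
  exists bpt; split=> // e f b _ /esym/diagonal_bptP ->.
  by rewrite tens_com_bptl !spmap_bpt.
case: da => // -[_ [e [f [b [eN ab]]]]].
exists (rm_act X f m k (h e m k (tens_com b s))); split=> // e' f' b' eN' ab'.
have b0 : b <> bpt by move=> b0; apply: a0; rewrite ab b0 ps_bpt.
have [l [u [u' [c [uf -> ->]]]]] := diagonal_span (etrans (esym ab) ab') b0.
(* Since [e] and [e'] are at most [N], naturality of [h] turns both values into the action of one
   composite surjection on the value at [c]. *)
by rewrite !hN.2 // -!rm_actE uf.
Qed.

(** The choice is harmless, as [forced_value] determines the value at a degenerate simplex. *)
Definition forced n m k (a : pf_psset degenerate_family n k) (s : sphere m k) : X n m k :=
  sval (cid (forced_value_ex s (svalP a))).

Lemma forcedP n m k (a : pf_psset degenerate_family n k) (s : sphere m k) :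
  forced_value (sval a) s (forced a s).
Proof. exact: svalP (cid (forced_value_ex s (svalP a))). Qed.

Lemma forced_bpt n m k (a : pf_psset degenerate_family n k) (s : sphere m k) :
  sval a = bpt -> forced a s = bpt.
Proof. exact: (forcedP a s).1. Qed.

Lemma forced_diagonal n m k (a : pf_psset degenerate_family n k) (s : sphere m k)
    e (f : surj n e) b : e <= N -> sval a = diagonal K f k b ->
  forced a s = rm_act X f m k (h e m k (tens_com b s)).
Proof. exact: (forcedP a s).2. Qed.

Definition forced_bimap n m :
  bimap (pf_psset degenerate_family n) (sphere m) (X n m).
Proof.
refine (@BiMap (pf_psset degenerate_family n) (sphere m) (X n m)
  (@forced n m) _ _ _).
- move=> l k f a s; have [a0|[_ [e [u [b [eN ab]]]]]] := svalP a.
    rewrite (forced_bpt s a0) bpt_act; apply: forced_bpt.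
    exact: etrans (congr1 (sact f) a0) (bpt_act _ f).
  rewrite (forced_diagonal s eN ab) -ss_nat -ss_nat tens_com_act.
  apply: forced_diagonal => //.
  exact: etrans (congr1 (sact f) ab) (esym (ss_nat _ f b)).
- by move=> k s; exact: forced_bpt.
- move=> k a; have [a0|[_ [e [u [b [eN ab]]]]]] := svalP a.
    exact: forced_bpt.
  by rewrite (forced_diagonal _ eN ab) tens_com_bptr !spmap_bpt.
Defined.

Definition forced_lev n : spmap (tensor (pf_psset degenerate_family n) sphere) (X n).
Proof.
apply: (@tensor_rec _ _ _ (forced_bimap n)).
- move=> m u k a s /=; have [a0|[_ [e [f [b [eN ab]]]]]] := svalP a.
    by rewrite !forced_bpt // ps_bpt.
  by rewrite !(forced_diagonal _ eN ab) -tens_com_pact !sp_pact.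
- move=> m k u a s /=; have [a0|[_ [e [f [b [eN ab]]]]]] := svalP a.
    by rewrite !forced_bpt // bi_ptr.
  by rewrite !(forced_diagonal _ eN ab) -tens_com_sigma !sp_sigma.
Defined.

Lemma forced_levE n m k (a : pf_psset degenerate_family n k) (s : sphere m k) :
  forced_lev n m k (tens a s) = forced a s.
Proof. exact: tensor_recE. Qed.

Definition forced_map : sqmap (pf_symseq degenerate_family) (underlying X).
Proof.
refine (@SqMap (pf_symseq degenerate_family) (underlying X) forced_lev _).
move=> n u; apply: tensor_spmap_eq => m k a s.
rewrite [LHS]sp_compE [RHS]sp_compE [X in _ = _ X]forced_levE.
rewrite [X in _ X = _]tensor_mapE [LHS]forced_levE.
have [a0|[_ [e [f [b [eN ab]]]]]] := svalP a.
  rewrite (forced_bpt s a0) spmap_bpt; apply: forced_bpt.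
  exact: etrans (congr1 _ a0) (ps_bpt _ _).
rewrite (forced_diagonal _ eN ab) -rm_actE; apply: forced_diagonal => //.
exact: etrans (congr1 _ ab) (esym (diagonal_comp _ _ _)).
Defined.

(** On a presented simplex, [g] commutes with the action of [f], and [h] is already a section of [g]
    at [b], whose arity is at most [N]. *)
Lemma forced_square :
  sq_comp (underlying_map g) forced_map =
  sq_comp (pf_to_com level_family) (pf_incl degenerate_level).
Proof.
apply: sqmap_eq => n; apply: tensor_spmap_eq => m k a s.
rewrite [LHS]sp_compE [RHS]sp_compE [X in _ X = _]forced_levE.
rewrite [X in _ = _ X]tensor_mapE [RHS]pf_to_com_levE.
have [a0|[_ [e [f [b [eN ab]]]]]] := svalP a.
  by rewrite forced_bpt // [LHS]spmap_bpt /= a0 tens_com_bptl.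
rewrite (forced_diagonal _ eN ab) [LHS]rm_natE hN.1 // tens_com_diagonal.
by rewrite /= ab.
Qed.

Definition level_psmap : psmap (smash_pow K N.+1) (pf_psset level_family N.+1).
Proof.
unshelve refine (@PSMap (smash_pow K N.+1) (pf_psset level_family N.+1)
  (@SSMap (smash_pow K N.+1) (pf_psset level_family N.+1)
    (fun k a => exist (level_family N.+1 k) a (or_intror erefl)) _) _).
- by move=> m k f a; apply: eq_exist.
- by move=> k; apply: eq_exist.
Defined.

(** A lift [t] in the square of [forced_square] supplies the component in arity [N + 1]: the lower
    triangle gives the section property, equivariance gives naturality along permutations, and the
    upper triangle gives it along the other surjections. *)
Lemma partial_section_step :
  lifts (pf_incl degenerate_level : hom (c := SymSp) _ _)
        (underlying_map g : hom (c := SymSp) _ _) ->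
  exists h', partial_section N.+1 h' /\ forall n, n <= N -> h' n = h n.
Proof.
move=> /(_ forced_map (pf_to_com level_family) forced_square).
case=> /= t [tA tB].
have {}tA n m k a s : t n m k (tens (pf_incl_psmap degenerate_level n k a) s) = forced a s.
  have := sqmap_eqE (tA : sq_comp t _ = _) (tens a s).
  rewrite [LHS]sp_compE [X in _ X = _ -> _]tensor_mapE => ->.
  exact: forced_levE.
have {}tB n m k (a : pf_psset level_family n k) (s : sphere m k) :
    g n m k (t n m k (tens a s)) = tens_com (sval a) s.
  have := sqmap_eqE (tB : sq_comp _ t = _) (tens a s).
  by rewrite [LHS]sp_compE => ->; exact: pf_to_com_levE.
have tE n (u : 'S_n) m k (a : pf_psset level_family n k) (s : sphere m k) :
    t n m k (tens (pf_act level_family u k a) s) =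
    rm_act X (surj_perm u) m k (t n m k (tens a s)).
  have := spmap_eqE (sq_equiv t u) (tens a s).
  by rewrite [LHS]sp_compE [X in _ X = _ -> _]tensor_mapE => ->.
pose top : spmap (tensor_com_lev K N.+1) (X N.+1) :=
  sp_comp (t N.+1) (tensor_map level_psmap (sp_id sphere)).
have topE m k (a : smash_pow K N.+1 k) (s : sphere m k) :
    top m k (tens_com a s) = t N.+1 m k (tens (level_psmap k a) s).
  by rewrite [LHS]sp_compE [X in _ X = _]tensor_mapE.
(* Only the component in arity [N + 1] is replaced. *)
pose h' := dfwith h top.
have h'in : h' N.+1 = top by exact: dfwith_in.
have h'out n : n <= N -> h' n = h n.
  by move=> nN; apply: dfwith_out; apply: contraTneq nN => <-; rewrite ltnn.
exists h'; split=> //; split.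
  move=> n m k a s; rewrite leq_eqVlt => /predU1P[nN|]; last first.
    by rewrite ltnS => nN; rewrite h'out // hN.1.
  by subst n; rewrite h'in topE tB.
move=> r n f m k a s; rewrite leq_eqVlt => /predU1P[rN|]; last first.
  rewrite ltnS => rN; have nN := leq_trans (surj_leq f) rN.
  by rewrite !h'out // hN.2.
subst r; rewrite h'in topE.
(* Either [f] is a permutation, or its target has arity at most [N] and the simplex lies in the fat
   diagonal. *)
have := surj_leq f; rewrite leq_eqVlt => /predU1P[nN|].
  subst n; have [u ->] := surj_permP f.
  by rewrite h'in topE -tE; congr (t _ _ _ (tens _ _)); apply: eq_exist.
rewrite ltnS => nN; rewrite h'out //.
have da : degenerate (diagonal K f k a) by right; split=> //; exists n, f, a.
have -> : level_psmap k (diagonal K f k a) =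
    pf_incl_psmap degenerate_level N.+1 k (exist _ _ da) by apply: eq_exist.
by rewrite tA; exact: forced_diagonal.
Qed.

End Step.

(** * Assembling the partial sections *)

(** In arity 0 both modules are trivial. *)
Lemma partial_section0 : partial_section 0 (fun n => zero_map _ _).
Proof.
split=> [n m k a s|r n f m k a s]; rewrite leqn0 => /eqP e0; subst.
  by case: (LHS); case: (RHS).
have /eqP n0 : n == 0 by rewrite -leqn0 (surj_leq f).
by subst n; rewrite [LHS]rm_zero [RHS]rm_zero.
Qed.

(** Each stage keeps the components of the previous one, so the diagonal family [h n], taken from
    stage [n], agrees with every later stage. *)
Lemma section_exists :
  (forall (P Q : pow_family K) (PQ : forall n k a, P n k a -> Q n k a),
     lifts (pf_incl PQ : hom (c := SymSp) _ _)
           (underlying_map g : hom (c := SymSp) _ _)) ->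
  exists h : rmmap (tensor_com K) X, rm_comp g h = rm_id (tensor_com K).
Proof.
move=> glift.
pose step N (p : {h | partial_section N h}) :=
  cid (partial_section_step (svalP p) (glift _ _ _)).
pose stage := fix stage N : {h | partial_section N h} :=
  match N with
  | 0 => exist _ _ partial_section0
  | N'.+1 => exist _ _ (svalP (step N' (stage N'))).1
  end.
pose h n := sval (stage n) n.
have stageE n N : n <= N -> sval (stage N) n = h n.
  elim: N => [|N IHN]; first by rewrite leqn0 => /eqP ->.
  rewrite leq_eqVlt => /predU1P[-> //|]; rewrite ltnS => nN.
  by rewrite -IHN //; exact: (svalP (step N (stage N))).2.
have hnat r n (f : surj r n) :
    sp_comp (h r) (rm_act (tensor_com K) f) = sp_comp (rm_act X f) (h n).
  apply: spmap_eq => m k x; have [a [s ->]] := tens_comP x.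
  rewrite [LHS]sp_compE [RHS]sp_compE [X in _ X = _]tens_com_diagonal.
  (* As [n <= r], both components can be read off at stage [r]. *)
  rewrite -(stageE n r (surj_leq f)).
  exact: (svalP (stage r)).2.
exists (@RMMap (tensor_com K) X h hnat).
apply: rmmap_eq => n; apply: spmap_eq => m k x.
have [a [s ->]] := tens_comP x; rewrite [LHS]sp_compE.
exact: (svalP (stage n)).1.
Qed.

End PartialSections.

(** * The retract argument and the conclusion *)

Definition zero_rmod : rmod.
Proof.
refine (@RMod (fun=> zero_spectrum) (fun _ _ _ => sp_id _) _ _ _).
- by [].
- by move=> *; apply: spmap_eq.
- by move=> m k [].
Defined.

Lemma zero_rmod_initial : is_initial (zero_rmod : RModCom).
Proof.
move=> M.
have zE n (f g : spmap zero_spectrum (M n)) : f = g.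
  apply: spmap_eq => m k []; exact: etrans (spmap_bpt f m k) (esym (spmap_bpt g m k)).
exists (@RMMap zero_rmod M (fun n => zero_map _ _) (fun r n f => zE r _ _)).
by move=> f; apply: rmmap_eq => n; exact: zE.
Qed.

(* Factor [o -> x] as a cofibration [i] followed by an acyclic fibration [p]: a
   section of [p] exhibits [o -> x] as a retract of [i]. *)
Lemma cofibrant_of_sections (C : category) (M : model_structure C) (o x : C) :
  is_initial o ->
  (forall (z : C) (p : hom z x), fib M p -> weq M p ->
     exists s : hom x z, comp p s = idm x) ->
  cofibrant M x.
Proof.
move=> o0 xsec; have [f _] := o0 x; exists o, f; split=> //.
have oE (y : C) (u v : hom o y) : u = v.
  by have [w wE] := o0 y; rewrite (wE u) (wE v).
have [z [i [p [fE icof pfib pweq]]]] := cof_acyclic_fib_factor M f.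
have [s ps] := xsec z p pfib pweq.
apply: cof_retract icof; exists (idm o), (idm o), s, p.
by split=> //; apply: oE.
Qed.

Theorem theorem4p4
  (MSp : model_structure Sp) (hSp : stable_model_structure MSp)
  (MSym : model_structure SymSp) (hSym : levelwise_model_structure MSp MSym)
  (MMod : model_structure RModCom) (hMod : created_model_structure MSym MMod)
  (K : psset) :
  cofibrant MMod (tensor_com K : RModCom).
Proof.
apply: cofibrant_of_sections zero_rmod_initial _ => X g /(hMod _ _ _).2 gfib.
move=> /(hMod _ _ _).1 gweq; apply: section_exists => P Q PQ.
(* The underlying map of [g] is an acyclic fibration of symmetric sequences, so only the inclusion
   must be shown to be a cofibration, which is a levelwise condition. *)
apply: cof_acyclic_fib_lifts gfib gweq; apply/(hSym _ _ _).2 => n.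
by apply: cof_tensor_sphere => //; exact: pf_incl_inj.
Qed.
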